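(* Let $R$ and $S$ be connected graphs with $R\neq P_3$ and $S\neq P_3$. Then $\{R,S\}$ is an $H^2$ forbidden pair if and only if $\{R,S\}=\{K_{1,3},Z_1\}$, i.e. one of the two graphs is $K_{1,3}$ and the other is $Z_1$.
   Context: All graphs are finite and simple. $P_k$ denotes the path on $k$ vertices and $K_{1,r}$ the star with $r$ leaves. $Z_1$ is the graph obtained from $K_{1,3}$ by adding one edge between two of its leaves (a triangle with a pendant edge). For a family $\mathcal F$ of graphs, a graph $G$ is $\mathcal F$-free if $G$ contains no induced subgraph isomorphic to a member of $\mathcal F$. The square of a graph is obtained by adding edges joining all pairs of vertices at distance two. A graph $G$ has an $H^2$ (a hamiltonian square) if $G$ contains, as a subgraph, the square of some hamiltonian cycle of $G$. A pair $\{R,S\}$ of connected graphs is an $H^2$ forbidden pair if every 4-connected $\{R,S\}$-free graph has an $H^2$.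
   Formalization: The formal theorem also assumes that at least one 4-connected {R,S}-free graph exists; without this, pairs such as {K_1,S} or {K_3,K_{1,3}} are forbidden pairs vacuously and the equivalence fails. *)

(* Defs.v *)
From mathcomp Require Import all_boot.

Set Implicit Arguments.
Unset Strict Implicit.
Unset Printing Implicit Defensive.

Record sgraph := SGraph {
  vertex :> finType;
  edge : rel vertex;
  edge_sym : symmetric edge;
  edge_irrefl : irreflexive edge }.

Definition isomorphic (G H : sgraph) : Prop :=
  exists2 f : G -> H, bijective f & forall x y : G, edge (f x) (f y) = edge x y.

Section Constructions.

Variable G : sgraph.

Section Induced.
Variable A : {set G}.

Definition induced_edge : rel {x : G | x \in A} :=
  fun x y => edge (val x) (val y).

Lemma induced_edge_sym : symmetric induced_edge.
Proof. by move=> x y; exact: edge_sym. Qed.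

Lemma induced_edge_irrefl : irreflexive induced_edge.
Proof. by move=> x; exact: edge_irrefl. Qed.

Definition induced : sgraph := SGraph induced_edge_sym induced_edge_irrefl.
End Induced.

Definition square_edge : rel G :=
  fun x y => (x != y) && (edge x y || [exists z, edge x z && edge z y]).

Lemma square_edge_sym : symmetric square_edge.
Proof.
move=> x y; rewrite /square_edge eq_sym edge_sym; congr (_ && (_ || _)).
by apply: eq_existsb => z; rewrite andbC (edge_sym z y) (edge_sym x z).
Qed.

Lemma square_edge_irrefl : irreflexive square_edge.
Proof. by move=> x; rewrite /square_edge eqxx. Qed.

Definition square : sgraph := SGraph square_edge_sym square_edge_irrefl.

Section AddEdge.
Variables a b : G.

Definition add_edge_edge : rel G :=
  fun x y =>
    edge x y || (x != y) && ((x == a) && (y == b) || (x == b) && (y == a)).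

Lemma add_edge_edge_sym : symmetric add_edge_edge.
Proof.
move=> x y; rewrite /add_edge_edge edge_sym (eq_sym x y) orbC.
by rewrite [in RHS]orbC (andbC (x == a)) (andbC (x == b)) (orbC (_ && (x == a))).
Qed.

Lemma add_edge_edge_irrefl : irreflexive add_edge_edge.
Proof. by move=> x; rewrite /add_edge_edge edge_irrefl eqxx. Qed.

Definition add_edge : sgraph := SGraph add_edge_edge_sym add_edge_edge_irrefl.
End AddEdge.

Section CycleSubgraph.
Variable c : seq G.

(* The spanning subgraph of G whose edges join cyclically consecutive entries
   of c; it is used only when c lists all the vertices of a cycle of G. *)
Definition cycle_edge : rel G :=
  fun x y => (x != y) && ((next c x == y) || (next c y == x)).

Lemma cycle_edge_sym : symmetric cycle_edge.
Proof. by move=> x y; rewrite /cycle_edge eq_sym orbC. Qed.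

Lemma cycle_edge_irrefl : irreflexive cycle_edge.
Proof. by move=> x; rewrite /cycle_edge eqxx. Qed.

Definition cycle_subgraph : sgraph := SGraph cycle_edge_sym cycle_edge_irrefl.
End CycleSubgraph.

End Constructions.

Definition path_edge k : rel 'I_k :=
  fun i j => (i.+1 == j :> nat) || (j.+1 == i :> nat).

Lemma path_edge_sym k : symmetric (@path_edge k).
Proof. by move=> i j; rewrite /path_edge orbC. Qed.

Lemma path_edge_irrefl k : irreflexive (@path_edge k).
Proof. by move=> i; rewrite /path_edge orbb gtn_eqF. Qed.

Definition path_graph k : sgraph :=
  SGraph (@path_edge_sym k) (@path_edge_irrefl k).

(* K_{1,r}: the centre is None, the leaves are the Some i. *)
Definition star_edge r : rel (option 'I_r) := fun x y => isSome x (+) isSome y.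

Lemma star_edge_sym r : symmetric (@star_edge r).
Proof. by move=> x y; rewrite /star_edge addbC. Qed.

Lemma star_edge_irrefl r : irreflexive (@star_edge r).
Proof. by move=> x; rewrite /star_edge addbb. Qed.

Definition star r : sgraph := SGraph (@star_edge_sym r) (@star_edge_irrefl r).

Definition Z1 : sgraph := @add_edge (star 3) (Some ord0) (Some ord_max).

(* The graph without vertices is not connected. *)
Definition connected (G : sgraph) : Prop :=
  0 < #|G| /\ forall x y : G, connect (@edge G) x y.

Definition kconnected (k : nat) (G : sgraph) : Prop :=
  k < #|G| /\ forall X : {set G}, #|X| < k -> connected (induced (~: X)).

Definition pair_free (R S G : sgraph) : Prop :=
  forall A : {set G}, ~ isomorphic (induced A) R /\ ~ isomorphic (induced A) S.

Definition hamiltonian_cycle (G : sgraph) (c : seq G) : Prop :=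
  [/\ 2 < size c, ucycle (@edge G) c & forall x : G, x \in c].

Definition has_H2 (G : sgraph) : Prop :=
  exists2 c : seq G, hamiltonian_cycle c &
    forall x y : G, @edge (square (cycle_subgraph c)) x y -> edge x y.

(* Vacuously true when no 4-connected graph is {R,S}-free: this happens when R
   or S has at most two vertices, and for {K_3, K_{1,3}} and {K_3, K_{1,4}}. *)
Definition H2_forbidden_pair (R S : sgraph) : Prop :=
  forall G : sgraph, kconnected 4 G -> pair_free R S G -> has_H2 G.

(* Main.v *)
(* If {R, S} is a forbidden pair, then R or S is an induced subgraph of every
   4-connected graph without a hamiltonian square. Five such graphs suffice:
   K_{4,4}, the Robertson graph (4-regular, girth 5), K_4 joined to three
   independent vertices, the join of two copies of K_1 + K_3, and the line graph
   of the Petersen graph. A connected graph with no triangle, no 4-cycle and no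
   induced P_4 is a star, which excludes most ways of distributing the five
   graphs between R and S; what remains is that R, say, is K_{1,3} or K_{1,4}
   (and K_4 joined to three vertices excludes the latter), and that S
   lies in the last two graphs, hence is K_3 or Z_1. Every 4-connected graph has
   a triangle or an induced K_{1,4}, so the assumption that some 4-connected
   graph is {R, S}-free rules out K_3.

   Conversely, in a 4-connected claw-free and Z_1-free graph each triangle is
   dominating in the strong sense that every vertex has two neighbours in it;
   so the graph is complete multipartite, with parts of size at most two. A
   cyclic order that puts nonadjacent vertices half a turn apart is then a
   hamiltonian cycle whose square is in the graph. *)
Require Import Defs.
From mathcomp Require Import all_boot.

Set Implicit Arguments.
Unset Strict Implicit.
Unset Printing Implicit Defensive.

(** * Graphs on an initial segment of the integers *)

Section NatGraph.
Variables (n : nat) (e : rel nat).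

(** Forcing symmetry and irreflexivity here turns every boolean relation into a simple graph; an
    adjacency entry counts only when it is listed from both ends. *)
Definition sym_rel : rel nat := fun i j => [&& i != j, e i j & e j i].

Definition nat_edge : rel 'I_n := fun i j => sym_rel i j.

Lemma nat_edge_sym : symmetric nat_edge.
Proof.
by move=> i j; rewrite /nat_edge /sym_rel eq_sym; congr andb; rewrite andbC.
Qed.

Lemma nat_edge_irrefl : irreflexive nat_edge.
Proof. by move=> i; rewrite /nat_edge /sym_rel eqxx. Qed.

Definition nat_graph := SGraph nat_edge_sym nat_edge_irrefl.

(* Graph search: [front] holds the reached vertices still to be expanded, [rest]
   the vertices not reached yet. With too little fuel the answer is [false]. *)
Fixpoint spans fuel (front rest : seq nat) : bool :=
  nilp rest || match fuel, front with
  | k.+1, v :: f => spans k ([seq w <- rest | sym_rel v w] ++ f)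
                            [seq w <- rest | ~~ sym_rel v w]
  | _, _ => false
  end.

(** Here [Q] stands for being joined to the root and [U] for being undeleted. Each expansion moves
    the neighbours of [v] from [rest] to [front], which preserves [Q] on [front]. *)
Lemma spansP (Q : pred nat) (U : nat -> Prop) fuel front rest :
  (forall v w, Q v -> U w -> sym_rel v w -> Q w) ->
  all Q front -> {in rest, forall w, U w} -> spans fuel front rest ->
  all Q rest.
Proof.
move=> QU; elim: fuel front rest => [|k IH] [|v f] rest;
  rewrite [spans _ _ _]/= ?orbF; try by move=> _ _ /nilP->.
case/andP=> Qv Qf Ur /orP[/nilP->//|/IH {}IH].
have Qn : all Q [seq w <- rest | sym_rel v w].
  apply/allP => x; rewrite mem_filter => /andP[vx /Ur Ux]; exact: QU vx.
have {}IH : all Q [seq w <- rest | ~~ sym_rel v w].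
  apply: IH => [|x]; first by rewrite all_cat Qn.
  by rewrite mem_filter => /andP[_ /Ur].
apply/allP => x xr; case vx: (sym_rel v x).
  by move/allP: Qn; apply; rewrite mem_filter vx.
by move/allP: IH; apply; rewrite mem_filter vx.
Qed.

Definition connected_minus (X : seq nat) : bool :=
  if [seq v <- iota 0 n | v \notin X] is v :: r then spans n [:: v] r
  else false.

Fixpoint small_subseqs k (s : seq nat) : seq (seq nat) :=
  match k, s with
  | k'.+1, x :: s' => map (cons x) (small_subseqs k' s') ++ small_subseqs k s'
  | _, _ => [:: [::]]
  end.

Lemma mem_small_subseqs k s t :
  subseq t s -> size t <= k -> t \in small_subseqs k s.
Proof.
elim: s k t => [|x s IH] [|k] [|y t] //=; rewrite mem_cat.
  by move=> _ _; apply/orP; right; apply: IH; rewrite ?sub0seq.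
case: (y =P x) => [-> ts tk|_ ts tk]; apply/orP; last by right; apply: IH.
by left; apply/map_f/IH.
Qed.

(** A deleted set, listed in increasing order, is a subsequence of [iota 0 n] of size at most
    [k.-1]; one search per such list settles connectivity by computation. *)
Lemma kconnected_nat_graph k :
  k < n -> all connected_minus (small_subseqs k.-1 (iota 0 n)) ->
  kconnected k nat_graph.
Proof.
move=> kn /allP chk; split=> [|X Xk]; first by rewrite card_ord.
pose s := [seq val i | i <- enum X].
have sX (i : 'I_n) : (val i \in s) = (i \in X).
  by rewrite mem_map ?mem_enum //; exact: val_inj.
have {chk}: connected_minus s.
  apply: chk; apply: mem_small_subseqs; last first.
    by rewrite size_map -cardE -ltnS (ltn_predK Xk).
  rewrite -val_enum_ord; apply: map_subseq.
  by rewrite {1}/enum_mem -enumT; apply: filter_subseq.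
rewrite /connected_minus.
have mem_alive v : v \in [seq w <- iota 0 n | w \notin s] ->
    exists y : induced (~: X : {set nat_graph}), val (val y) = v.
  rewrite mem_filter mem_iota add0n => /andP[vs /= vn].
  have yX : Ordinal vn \in ~: X by rewrite inE -sX.
  by exists (Sub (Ordinal vn) yX).
case E: [seq _ <- _ | _] mem_alive => [|v r] // mem_alive.
have [x0 x0v] := mem_alive v (mem_head _ _).
(* The numbers marked by [Q] are the values of surviving vertices joined to the first survivor. *)
pose Q : pred nat := fun w => [exists y : induced (~: X : {set nat_graph}),
  (val (val y) == w :> nat) && connect (@edge _) x0 y].
move/(@spansP Q (fun w => w \in v :: r)) => span.
have {}span : all Q (v :: r).
  have Qv : Q v by apply/existsP; exists x0; rewrite x0v eqxx connect0.
  rewrite /= Qv; apply: span; first last.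
  - by move=> w wr; rewrite inE wr orbT.
  - by rewrite /= Qv.
  move=> a b /existsP[y /andP[/eqP ya xy]] /mem_alive[z zb] ab.
  apply/existsP; exists z; rewrite zb eqxx /=.
  apply: connect_trans xy (connect1 _).
  by rewrite /edge /= /induced_edge /= /nat_edge ya zb.
have to_root y : connect (@edge (induced (~: X : {set nat_graph}))) x0 y.
  have : val (val y) \in v :: r.
    by rewrite -E mem_filter mem_iota /= ltn_ord sX -in_setC (valP y).
  move/(allP span) => /existsP[z /andP[/eqP /val_inj /val_inj -> ]] //.
split; first by apply/card_gt0P; exists x0.
move=> x y; apply: connect_trans (to_root y).
by rewrite sym_connect_sym //; exact: edge_sym.
Qed.

End NatGraph.

Definition adjacency (l : seq (seq nat)) : rel nat :=
  fun i j => j \in nth [::] l i.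

Lemma nat_forall3 n (P : nat -> nat -> nat -> bool) :
  (let r := iota 0 n in all (fun a => all (fun b => all (P a b) r) r) r) ->
  forall a b c : 'I_n, P a b c.
Proof.
move=> /= H a b c; have mem_r (i : 'I_n) : (i : nat) \in iota 0 n.
  by rewrite mem_iota /=.
by move/allP: H => /(_ a (mem_r a))/allP/(_ b (mem_r b))/allP/(_ c (mem_r c)).
Qed.

Lemma nat_forall4 n (P : nat -> nat -> nat -> nat -> bool) :
  all (fun a => let r := iota 0 n in
    all (fun b => all (fun c => all (P a b c) r) r) r) (iota 0 n) ->
  forall a b c d : 'I_n, P a b c d.
Proof.
move=> /allP H a; apply: nat_forall3; apply: H.
by rewrite mem_iota /=.
Qed.

(** * Induced subgraphs and forbidden patterns *)

(** A boolean, so that deciding which of [R] and [S] lies in an obstruction is a constructive case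
    analysis. *)
Definition embeds (X G : sgraph) : bool :=
  [exists f : {ffun X -> G},
    injectiveb f && [forall x, forall y, edge (f x) (f y) == edge x y]].

Lemma embedsP (X G : sgraph) :
  reflect (exists2 f : X -> G, injective f &
             forall x y, edge (f x) (f y) = edge x y) (embeds X G).
Proof.
apply: (iffP existsP) => [[f /andP[/injectiveP fI /forallP fE]]|[f fI fE]].
  by exists f => // x y; apply/eqP; move/forallP: (fE x); apply.
exists (finfun f); apply/andP; split.
  by apply/injectiveP => x y; rewrite !ffunE => /fI.
by apply/forallP => x; apply/forallP => y; rewrite !ffunE fE.
Qed.

Lemma embeds_trans (Y X G : sgraph) : embeds X Y -> embeds Y G -> embeds X G.
Proof.
move=> /embedsP[f fI fE] /embedsP[g gI gE]; apply/embedsP.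
by exists (g \o f) => [|x y]; [exact: inj_comp | rewrite /= gE fE].
Qed.

Lemma isomorphic_embeds (X Y : sgraph) : isomorphic X Y -> embeds X Y.
Proof. by case=> f /bij_inj fI fE; apply/embedsP; exists f. Qed.

Lemma isomorphic_sym (X Y : sgraph) : isomorphic X Y -> isomorphic Y X.
Proof.
case=> f [g fK gK] fE; exists g; first by exists f.
by move=> x y; rewrite -fE !gK.
Qed.

Lemma embeds_isomorphic (X Y : sgraph) :
  embeds X Y -> #|Y| <= #|X| -> isomorphic X Y.
Proof.
by move=> /embedsP[f fI fE] YX; exists f => //; exact: inj_card_bij.
Qed.

Lemma embeds_induced (X G : sgraph) :
  embeds X G -> exists A : {set G}, isomorphic (induced A) X.
Proof.
case/embedsP=> f fI fE; exists [set f x | x : X]; apply: isomorphic_sym.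
have fA x : f x \in [set f x | x : X] by exact: imset_f.
apply: embeds_isomorphic; last by rewrite card_sig card_imset.
apply/embedsP; exists (fun x => Sub (f x) (fA x) : induced [set f x | x : X]).
  by move=> x y /(congr1 val) /= /fI.
by move=> x y; rewrite -fE.
Qed.

Lemma pair_freeP (R S G : sgraph) :
  pair_free R S G <-> ~~ embeds R G /\ ~~ embeds S G.
Proof.
split=> [RS|[RG SG] A].
  split; apply/negP => /embeds_induced[A iA]; have [nR nS] := RS A.
    exact: nR.
  exact: nS.
have emb X : isomorphic (induced A) X -> embeds X G.
  move/isomorphic_sym/isomorphic_embeds/embeds_trans; apply.
  by apply/embedsP; exists val; [exact: val_inj |].
by split=> /emb; apply/negP.
Qed.

(** * Small patterns as boolean predicates *)

Section Patterns.
Variables (T : eqType) (e : rel T).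
Implicit Types a b c d : T.

(** The patterns take an arbitrary [eqType] and relation, so that on a [nat_graph] they convert to
    predicates on [nat], which can be evaluated. *)
Definition is_triangle a b c := [&& e a b, e b c & e a c].

Definition is_independent3 a b c :=
  [&& a != b, a != c, b != c, ~~ e a b, ~~ e a c & ~~ e b c].

Definition is_independent4 a b c d :=
  [&& a != b, a != c, a != d, is_independent3 b c d,
      ~~ e a b, ~~ e a c & ~~ e a d].

(* When [e] is symmetric and irreflexive the six conditions force the four
   vertices to be distinct; the same holds for [is_paw] and [is_2K2]. *)
Definition is_P4 a b c d :=
  [&& e a b, e b c, e c d, ~~ e a c, ~~ e a d & ~~ e b d].

(* A 4-cycle that need not be induced. *)
Definition is_quad a b c d :=
  [&& e a b, e b c, e c d, e d a, a != c & b != d].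

Definition is_C4 a b c d := [&& is_quad a b c d, ~~ e a c & ~~ e b d].

Definition is_claw a b c d :=
  [&& e a b, e a c, e a d & is_independent3 b c d].

Definition is_paw a b c d :=
  [&& is_triangle a b c, e a d, ~~ e b d & ~~ e c d].

Definition is_2K2 a b c d :=
  [&& e a b, e c d, ~~ e a c, ~~ e a d, ~~ e b c & ~~ e b d].

End Patterns.

Section Freeness.
Variable X : sgraph.

Definition triangle_free := forall a b c : X, ~~ is_triangle (@edge X) a b c.
Definition alpha_le2 := forall a b c : X, ~~ is_independent3 (@edge X) a b c.
Definition alpha_le3 :=
  forall a b c d : X, ~~ is_independent4 (@edge X) a b c d.
Definition P4_free := forall a b c d : X, ~~ is_P4 (@edge X) a b c d.
Definition quad_free := forall a b c d : X, ~~ is_quad (@edge X) a b c d.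
Definition C4_free := forall a b c d : X, ~~ is_C4 (@edge X) a b c d.
Definition claw_free := forall a b c d : X, ~~ is_claw (@edge X) a b c d.
Definition paw_free := forall a b c d : X, ~~ is_paw (@edge X) a b c d.
Definition twoK2_free := forall a b c d : X, ~~ is_2K2 (@edge X) a b c d.

End Freeness.

Section Hereditary.
Variables (X G : sgraph).
Hypothesis XG : embeds X G.

Lemma triangle_free_embeds : triangle_free G -> triangle_free X.
Proof.
case/embedsP: XG => f fI fE GP a b c; move: (GP (f a) (f b) (f c)).
by rewrite /is_triangle !fE.
Qed.

Lemma alpha_le2_embeds : alpha_le2 G -> alpha_le2 X.
Proof.
case/embedsP: XG => f fI fE GP a b c; move: (GP (f a) (f b) (f c)).
by rewrite /is_independent3 !fE !(inj_eq fI).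
Qed.

Lemma alpha_le3_embeds : alpha_le3 G -> alpha_le3 X.
Proof.
case/embedsP: XG => f fI fE GP a b c d; move: (GP (f a) (f b) (f c) (f d)).
by rewrite /is_independent4 /is_independent3 !fE !(inj_eq fI).
Qed.

Lemma P4_free_embeds : P4_free G -> P4_free X.
Proof.
case/embedsP: XG => f fI fE GP a b c d; move: (GP (f a) (f b) (f c) (f d)).
by rewrite /is_P4 !fE.
Qed.

Lemma quad_free_embeds : quad_free G -> quad_free X.
Proof.
case/embedsP: XG => f fI fE GP a b c d; move: (GP (f a) (f b) (f c) (f d)).
by rewrite /is_quad !fE !(inj_eq fI).
Qed.

Lemma C4_free_embeds : C4_free G -> C4_free X.
Proof.
case/embedsP: XG => f fI fE GP a b c d; move: (GP (f a) (f b) (f c) (f d)).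
by rewrite /is_C4 /is_quad !fE !(inj_eq fI).
Qed.

Lemma claw_free_embeds : claw_free G -> claw_free X.
Proof.
case/embedsP: XG => f fI fE GP a b c d; move: (GP (f a) (f b) (f c) (f d)).
by rewrite /is_claw /is_independent3 !fE !(inj_eq fI).
Qed.

Lemma paw_free_embeds : paw_free G -> paw_free X.
Proof.
case/embedsP: XG => f fI fE GP a b c d; move: (GP (f a) (f b) (f c) (f d)).
by rewrite /is_paw /is_triangle !fE.
Qed.

Lemma twoK2_free_embeds : twoK2_free G -> twoK2_free X.
Proof.
case/embedsP: XG => f fI fE GP a b c d; move: (GP (f a) (f b) (f c) (f d)).
by rewrite /is_2K2 !fE.
Qed.

End Hereditary.

(** * The five obstructions *)

Definition K44 := nat_graph 8 (fun i j => odd i (+) odd j).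

Definition K4_join_3K1 := nat_graph 7 (fun i j => (i < 4) || (j < 4)).

(* The two parts are the even and the odd vertices; in each of them the vertex
   0, resp. 1, is isolated and the other three form a triangle. *)
Definition K1_K3_square_join :=
  nat_graph 8 (fun i j => odd i (+) odd j || (1 < i) && (1 < j)).

(** The vertices are numbered along a hamiltonian cycle, so each list contains the two cyclically
    adjacent numbers. *)
Definition robertson := nat_graph 19 (adjacency
  [:: [:: 1; 4; 8; 18]; [:: 0; 2; 12; 15]; [:: 1; 3; 6; 10]; [:: 2; 4; 13; 16];
      [:: 0; 3; 5; 11]; [:: 4; 6; 9; 15]; [:: 2; 5; 7; 18]; [:: 6; 8; 11; 16];
      [:: 0; 7; 9; 13]; [:: 5; 8; 10; 17]; [:: 2; 9; 11; 14]; [:: 4; 7; 10; 12];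
      [:: 1; 11; 13; 17]; [:: 3; 8; 12; 14]; [:: 10; 13; 15; 18];
      [:: 1; 5; 14; 16]; [:: 3; 7; 15; 17]; [:: 9; 12; 16; 18];
      [:: 0; 6; 14; 17]]).

(** For the Petersen graph, [0] to [4] are the edges of the outer pentagon, [5] to [9] the spokes
    and [10] to [14] the edges of the inner pentagram. *)
Definition line_petersen := nat_graph 15 (adjacency
  [:: [:: 1; 4; 5; 6]; [:: 0; 2; 6; 7]; [:: 1; 3; 7; 8]; [:: 2; 4; 8; 9];
      [:: 0; 3; 5; 9]; [:: 0; 4; 10; 13]; [:: 0; 1; 11; 14]; [:: 1; 2; 10; 12];
      [:: 2; 3; 11; 13]; [:: 3; 4; 12; 14]; [:: 5; 7; 12; 13];
      [:: 6; 8; 13; 14]; [:: 7; 9; 10; 14]; [:: 5; 8; 10; 11];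
      [:: 6; 9; 11; 12]]).

Lemma K44_4conn : kconnected 4 K44.
Proof. by apply: kconnected_nat_graph; last vm_compute. Qed.

Lemma K4_join_3K1_4conn : kconnected 4 K4_join_3K1.
Proof. by apply: kconnected_nat_graph; last vm_compute. Qed.

Lemma K1_K3_square_join_4conn : kconnected 4 K1_K3_square_join.
Proof. by apply: kconnected_nat_graph; last vm_compute. Qed.

Lemma robertson_4conn : kconnected 4 robertson.
Proof. by apply: kconnected_nat_graph; last vm_compute. Qed.

Lemma line_petersen_4conn : kconnected 4 line_petersen.
Proof. by apply: kconnected_nat_graph; last vm_compute. Qed.

Ltac check_pattern3 pattern :=
  match goal with |- _ (nat_graph ?n ?e) =>
    apply: (@nat_forall3 n (fun a b c => ~~ pattern nat (sym_rel e) a b c))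
  end; by vm_compute.

Ltac check_pattern4 pattern :=
  match goal with |- _ (nat_graph ?n ?e) =>
    apply: (@nat_forall4 n (fun a b c d => ~~ pattern nat (sym_rel e) a b c d))
  end; by vm_compute.

Lemma K44_triangle_free : triangle_free K44.
Proof. rewrite /K44; check_pattern3 @is_triangle. Qed.

Lemma K44_P4_free : P4_free K44.
Proof. rewrite /K44; check_pattern4 @is_P4. Qed.

Lemma K4_join_3K1_P4_free : P4_free K4_join_3K1.
Proof. rewrite /K4_join_3K1; check_pattern4 @is_P4. Qed.

Lemma K4_join_3K1_C4_free : C4_free K4_join_3K1.
Proof. rewrite /K4_join_3K1; check_pattern4 @is_C4. Qed.

Lemma K4_join_3K1_paw_free : paw_free K4_join_3K1.
Proof. rewrite /K4_join_3K1; check_pattern4 @is_paw. Qed.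

Lemma K4_join_3K1_alpha_le3 : alpha_le3 K4_join_3K1.
Proof. rewrite /K4_join_3K1; check_pattern4 @is_independent4. Qed.

Lemma K1_K3_square_join_alpha_le2 : alpha_le2 K1_K3_square_join.
Proof. rewrite /K1_K3_square_join; check_pattern3 @is_independent3. Qed.

Lemma K1_K3_square_join_P4_free : P4_free K1_K3_square_join.
Proof. rewrite /K1_K3_square_join; check_pattern4 @is_P4. Qed.

Lemma K1_K3_square_join_twoK2_free : twoK2_free K1_K3_square_join.
Proof. rewrite /K1_K3_square_join; check_pattern4 @is_2K2. Qed.

Lemma robertson_triangle_free : triangle_free robertson.
Proof. rewrite /robertson; check_pattern3 @is_triangle. Qed.

Lemma robertson_quad_free : quad_free robertson.
Proof. rewrite /robertson; check_pattern4 @is_quad. Qed.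

Lemma line_petersen_claw_free : claw_free line_petersen.
Proof. rewrite /line_petersen; check_pattern4 @is_claw. Qed.

Lemma line_petersen_quad_free : quad_free line_petersen.
Proof. rewrite /line_petersen; check_pattern4 @is_quad. Qed.

(** * Stars and triangles *)

Lemma connected_ind (X : sgraph) (P : pred X) (x : X) :
  connected X -> P x -> (forall u v, P u -> edge u v -> P v) -> forall z, P z.
Proof.
case=> _ cX Px step z; have /connectP[p xp ->] := cX x z.
elim: p x Px xp => [|y p IH] x Px //= /andP[xy yp].
by apply: IH yp; apply: step xy.
Qed.

Lemma star_embeds (G : sgraph) k (x : G) (A : {set G}) :
  k <= #|A| -> {in A, forall y, edge x y} ->
  {in A &, forall y z, ~~ edge y z} -> embeds (star k) G.
Proof.
move=> kA xA indep; apply/embedsP.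
pose leaf (i : 'I_k) := enum_val (widen_ord kA i).
have leafA i : leaf i \in A by exact: enum_valP.
have x_neq i : x <> leaf i.
  by move=> xi; have := xA _ (leafA i); rewrite -xi edge_irrefl.
exists (fun o => if o is Some i then leaf i else x).
  move=> [i|] [j|] //=; last 1 first.
  - by move/x_neq.
  - by move=> /enum_val_inj /(congr1 val) /= /val_inj ->.
  - by move/esym/x_neq.
move=> [i|] [j|]; rewrite /= ?edge_irrefl ?xA //.
  exact/negbTE/indep.
by rewrite edge_sym xA.
Qed.

Lemma star_subgraph k r : k <= r -> embeds (star k) (star r).
Proof.
move=> kr; apply: (@star_embeds (star r) k None [set Some i | i : 'I_r]).
- by rewrite card_imset ?card_ord //; exact: Some_inj.
- by move=> _ /imsetP[i _ ->].
- by move=> _ _ /imsetP[i _ ->] /imsetP[j _ ->].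
Qed.

Lemma connected_star (X : sgraph) :
  connected X -> triangle_free X -> quad_free X -> P4_free X ->
  exists r, isomorphic X (star r).
Proof.
move=> cX tX qX pX.
have [x center] : exists x : X, forall z, (z == x) || edge x z.
  (* Every edge has an end of degree one: otherwise it extends to a path [u], [x], [y], [v], whose
     possible chords [uy] and [xv] close a triangle, while [uv] decides between a 4-cycle and an
     induced path. *)
  have leaf (x y : X) : edge x y ->
      (forall u, edge x u -> u = y) \/ (forall v, edge y v -> v = x).
    move=> xy.
    case: (pickP [pred u | edge x u & u != y]) => [u /andP[xu uy]|nu].
      right=> v yv; apply/eqP/negPn/negP => vx.
      have uNy : ~~ edge u y.
        by have := tX x u y; rewrite /is_triangle xu xy andbT.
      have xNv : ~~ edge x v by have := tX x y v; rewrite /is_triangle xy yv.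
      case uv: (edge u v).
        have := qX x y v u; rewrite /is_quad xy yv edge_sym uv (edge_sym u) xu.
        by rewrite eq_sym vx eq_sym uy.
      have := pX u x y v; rewrite /is_P4 (edge_sym u x) xu xy yv uNy xNv uv.
      by [].
    left=> u xu; apply/eqP; have := nu u; rewrite /= xu /=.
    by move/negbFE.
  case: (pickP [pred p : X * X | edge p.1 p.2]) => [[x y] /= xy|noedge].
    (* Up to exchanging the ends, [y] is a leaf; the other end [x] is the centre. *)
    have {x y xy} [x [y [xy y_leaf]]] : exists x y : X, edge x y /\
        forall v, edge y v -> v = x.
      have [H|H] := leaf _ _ xy; last by exists x, y.
      by exists y, x; rewrite edge_sym.
    exists x; apply: (connected_ind (x := x) cX) => [|u v] /=.
      by rewrite eqxx.
    case/orP=> [/eqP -> ->|xu uv]; first by rewrite orbT.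
    have [x_leaf|u_leaf] := leaf _ _ xu; last by rewrite (u_leaf v) ?eqxx.
    by move: uv; rewrite -(x_leaf _ xy) => /y_leaf ->; rewrite eqxx.
  (* Without edges, connectedness leaves a single vertex, the star with no leaves. *)
  have [/card_gt0P[x _] _] := cX; exists x.
  apply: (connected_ind (x := x) cX) => [|u v _ uv] /=; first by rewrite eqxx.
  by have := noedge (u, v); rewrite /= uv.
set A := [set z | edge x z]; exists #|A|; apply: isomorphic_sym.
apply: embeds_isomorphic.
  apply: (@star_embeds X _ x A) => // [y|y z]; rewrite ?inE // => xy xz.
  by have := tX x y z; rewrite /is_triangle xy xz andbT.
rewrite card_option card_ord -cardsT.
have -> : [set: X] = x |: A.
  by apply/setP => z; rewrite !inE center.
by rewrite cardsU1 inE edge_irrefl.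
Qed.

Lemma star_claw_free r : claw_free (star r) -> r <= 2.
Proof.
rewrite leqNgt => H; apply/negP => /star_subgraph/claw_free_embeds/(_ H) {}H.
by have /negP[] := H None (Some ord0) (Some (Ordinal (isT : 1 < 3)))
  (Some ord_max).
Qed.

Lemma alpha_le2_claw_free X : alpha_le2 X -> claw_free X.
Proof. by move=> H a b c d; rewrite /is_claw (negbTE (H b c d)) !andbF. Qed.

Lemma star_alpha_le3 r : alpha_le3 (star r) -> r <= 3.
Proof.
rewrite leqNgt => H; apply/negP => /star_subgraph/alpha_le3_embeds/(_ H) {}H.
by have /negP[] := H (Some ord0) (Some (Ordinal (isT : 1 < 4)))
  (Some (Ordinal (isT : 2 < 4))) (Some ord_max).
Qed.

Lemma star_max_degree (G : sgraph) r :
  embeds (star r) G -> exists x : G, r <= #|[set y | edge x y]|.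
Proof.
case/embedsP=> f fI fE; exists (f None).
have fI' : injective (fun i : 'I_r => f (Some i)) by move=> i j /fI[].
rewrite -[X in X <= _]card_ord -cardsT -(card_imset _ fI').
apply: subset_leq_card; apply/subsetP => _ /imsetP[i _ ->].
by rewrite inE /= fE.
Qed.

Lemma Z1_not_paw_free : ~ paw_free Z1.
Proof.
move=> H; have /negP[] := H None (Some ord0) (Some ord_max)
  (Some (Ordinal (isT : 1 < 3))); by [].
Qed.

Lemma Z1_embeds (G : sgraph) (a b c d : G) :
  is_paw (@edge G) a b c d -> embeds Z1 G.
Proof.
case/and4P=> /and3P[ab bc ac] ad /negbTE bd /negbTE cd.
(* The added edge of [Z1] joins the first and the last leaf, so [b] and [c] go there and the pendant
   vertex [d] goes in between. *)
pose f (o : Z1) := nth a [:: a; b; d; c] (if o is Some i then i.+1 else 0).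
have neq (x y : G) : edge x y -> x != y.
  by move=> xy; apply: contraTneq xy => ->; rewrite edge_irrefl.
have bNd : b != d by apply: contraFneq cd => <-; rewrite edge_sym.
have cNd : d != c by apply: contraFneq bd => ->.
have U : uniq [:: a; b; d; c].
  rewrite /= !inE !negb_or bNd cNd.
  by rewrite (neq _ _ ab) (neq _ _ ac) (neq _ _ ad) neq.
apply/embedsP; exists f.
  have ltf (o : Z1) : (if o is Some i then i.+1 else 0) < 4.
    by case: o => [i|]; [exact: (ltn_ord i)|].
  move=> o p /eqP; rewrite nth_uniq ?ltf // => {}/eqP.
  by case: o p => [i|] [j|] //= [/val_inj->].
have [ba cb ca da] : [/\ edge b a, edge c b, edge c a & edge d a].
  by rewrite !(edge_sym _ a) (edge_sym c).
have [db dc] : edge d b = false /\ edge d c = false by rewrite !(edge_sym d).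
move=> [[[|[|[|//]]] ?]|] [[[|[|[|//]]] ?]|].
all: match goal with |- _ = ?X =>
  first [change X with true | change X with false] end; rewrite /f /=.
all: first [exact: edge_irrefl | assumption].
Qed.

(** * Absence of hamiltonian squares *)

(** All that the obstructions use of a hamiltonian square is its successor map; more than four
    vertices make five consecutive ones distinct. *)
Lemma H2_successor (G : sgraph) :
  has_H2 G -> 4 < #|G| ->
  exists2 f : G -> G, injective f &
    forall x, [/\ edge x (f x), edge x (f (f x)) & uniq (traject f x 5)].
Proof.
case=> c [_ /andP[_ Uc] c_all] sq n_gt4; exists (next c) => [|x].
  exact: can_inj (prev_next Uc).
have U5 : uniq (traject (next c) x 5).
  have : 5 <= order (next c) x.
    rewrite (order_cycle (cycle_next Uc) Uc (c_all x)) -(card_uniqP Uc).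
    by rewrite (eq_card (B := G)) // => y; rewrite c_all.
  by move/(take_traject (next c) x) <-; rewrite take_uniq ?orbit_uniq.
have [x_fx x_ffx fx_ffx] : let f := next c in
    [/\ x != f x, x != f (f x) & f x != f (f x)].
  move: U5 => /(take_uniq 3) /=; rewrite !inE !negb_or -andbA.
  by case/and4P.
have step y : y != next c y -> @edge (cycle_subgraph c) y (next c y).
  by move=> yN; rewrite /edge /= /cycle_edge yN eqxx.
split; last exact: U5; apply: sq; rewrite /= /edge /= /square_edge.
  by rewrite x_fx step.
rewrite x_ffx; apply/orP; right; apply/existsP; exists (next c x).
by rewrite !step.
Qed.

(** Four consecutive vertices [a], [b], [c], [d] of a hamiltonian square span the 4-cycle [a], [b],
    [d], [c]. *)
Lemma quad_free_no_H2 (G : sgraph) : 4 < #|G| -> quad_free G -> ~ has_H2 G.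
Proof.
move=> n_gt4 qG /H2_successor/(_ n_gt4)[f _ fE].
have /card_gt0P[a _] : 0 < #|G| by apply: leq_trans n_gt4.
have [a1 a2 /=] := fE a; have [b1 b2 _] := fE (f a).
have [c1 _ _] := fE (f (f a)).
rewrite !inE !negb_or -!andbA => /and5P[_ _ a_fffa _ /and4P[fa_ffa _ _ _]].
have /negP := qG a (f a) (f (f (f a))) (f (f a)); apply.
rewrite /is_quad a1 b2 edge_sym c1 edge_sym a2.
by rewrite a_fffa fa_ffa.
Qed.

Lemma triangle_free_no_H2 (G : sgraph) :
  4 < #|G| -> triangle_free G -> ~ has_H2 G.
Proof.
move=> n_gt4 tG /H2_successor/(_ n_gt4)[f _ fE].
have /card_gt0P[a _] : 0 < #|G| by apply: leq_trans n_gt4.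
have [a1 a2 _] := fE a; have [b1 _ _] := fE (f a).
by have := tG a (f a) (f (f a)); rewrite /is_triangle a1 a2 b1.
Qed.

Lemma K44_no_H2 : ~ has_H2 K44.
Proof.
by apply: triangle_free_no_H2 K44_triangle_free; rewrite card_ord.
Qed.

Lemma robertson_no_H2 : ~ has_H2 robertson.
Proof.
by apply: triangle_free_no_H2 robertson_triangle_free; rewrite card_ord.
Qed.

Lemma line_petersen_no_H2 : ~ has_H2 line_petersen.
Proof.
by apply: quad_free_no_H2 line_petersen_quad_free; rewrite card_ord.
Qed.

Lemma card_nat_graph n e (P : pred nat) :
  #|[set i : nat_graph n e | P i]| = count P (iota 0 n).
Proof.
rewrite cardsE -sum1_card -(big_mkord P (fun=> 1)) sum1_count.
by rewrite /index_iota subn0.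
Qed.

(** The three independent vertices, their successors and their second successors would be nine
    distinct vertices out of seven. *)
Lemma K4_join_3K1_no_H2 : ~ has_H2 K4_join_3K1.
Proof.
move/H2_successor; rewrite card_ord => /(_ isT)[f fI fE].
pose A := [set i : K4_join_3K1 | 3 < i].
have indep : {in A &, forall i j, ~~ edge i j}.
  have lt4 k : 3 < k -> (k < 4) = false by rewrite [k < 4]ltnNge => ->.
  move=> i j; rewrite !inE => /lt4 i4 /lt4 j4.
  by rewrite /edge /= /nat_edge /sym_rel i4 j4 andbF.
have A1 : [disjoint A & f @: A].
  rewrite disjoint_sym disjoints_subset; apply/subsetP => _ /imsetP[x xA ->].
  by rewrite inE; apply/negP => /(indep _ _ xA); have [->] := fE x.
have A2 : [disjoint A & f @: (f @: A)].
  rewrite disjoint_sym disjoints_subset.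
  apply/subsetP => _ /imsetP[_ /imsetP[x xA ->] ->].
  by rewrite inE; apply/negP => /(indep _ _ xA); have [_ ->] := fE x.
have A12 : [disjoint f @: A & f @: (f @: A)] by rewrite imset_disjoint ?in2W.
have A3 : #|A| = 3.
  exact: card_nat_graph.
have := subset_leq_card (subsetT (A :|: (f @: A :|: f @: (f @: A)))).
rewrite cardsT card_ord cardsU.
move: A1 A2 A12; rewrite -!setI_eq0 => /eqP A1 /eqP A2 /eqP A12.
by rewrite setIUr A1 A2 setU0 cards0 subn0 cardsU A12 cards0 !card_imset // A3.
Qed.

(** The two vertices before [v] and the two after it form a path on four neighbours of [v]. But the
    neighbourhood of the vertex [0] is a copy of [K_1 + K_3], which has no such path. *)
Lemma K1_K3_square_join_no_H2 : ~ has_H2 K1_K3_square_join.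
Proof.
move/H2_successor; rewrite card_ord => /(_ isT)[f fI fE].
pose v : K1_K3_square_join := ord0.
pose a := invF fI (invF fI v).
have fa : f (f a) = v by rewrite !f_invF.
have [a1 a2 a_uniq] := fE a; have [b1 b2 _] := fE (f a).
have [c1 c2 _] := fE v; have [d1 _ _] := fE (f v).
rewrite fa in a2 b1 b2; move: a_uniq; rewrite /= !inE fa !negb_or -!andbA.
case/and5P=> _ _ a_fv a_ffv /and5P[_ _ fa_ffv _ _].
(* Consecutive vertices of the path differ because they are adjacent; these three inequalities make
   all four distinct. *)
have H : forall a b c d : 'I_8, ~~ [&& a != c, a != d & b != d] ||
    ~~ [&& @edge K1_K3_square_join v a, @edge K1_K3_square_join v b,
  @edge K1_K3_square_join v c, @edge K1_K3_square_join v d,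
  @edge K1_K3_square_join a b, @edge K1_K3_square_join b c &
  @edge K1_K3_square_join c d].
  pose e := sym_rel (fun i j => odd i (+) odd j || (1 < i) && (1 < j)).
  apply: (@nat_forall4 8 (fun a b c d => ~~ [&& a != c, a != d & b != d] ||
    ~~ [&& e 0 a, e 0 b, e 0 c, e 0 d, e a b, e b c & e c d])).
  by vm_compute.
have := H a (f a) (f v) (f (f v)).
by rewrite a_fv a_ffv fa_ffv (edge_sym v a) a2 (edge_sym v) b1 c1 c2 a1 b2 d1.
Qed.

Lemma robertson_degree (x : robertson) : #|[set y | edge x y]| <= 4.
Proof.
rewrite (@card_nat_graph 19 _ (sym_rel _ x)).
set e := sym_rel _.
have /allP : all (fun x => count (e x) (iota 0 19) <= 4) (iota 0 19).
  by vm_compute.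
by apply; rewrite mem_iota /=.
Qed.

(** * The forbidden pair *)

(** Deleting a neighbourhood of fewer than [k] vertices would isolate [x] while leaving some other
    vertex, as there are more than [k] vertices. *)
Lemma kconnected_degree k (G : sgraph) (x : G) :
  kconnected k G -> k <= #|[set y | edge x y]|.
Proof.
case=> kG conn; rewrite leqNgt; apply/negP => degx.
set N := [set y | edge x y] in degx; have cN := conn N degx.
have xN : x \in ~: N by rewrite !inE edge_irrefl.
have /subsetPn[y _ yxN] : ~~ ([set: G] \subset x |: N).
  apply: contraL kG => /subset_leq_card; rewrite cardsT -leqNgt.
  by move/leq_trans; apply; rewrite cardsU1 inE edge_irrefl.
move: yxN; rewrite in_setU1 negb_or => /andP[yx yN].
have {}yN : y \in ~: N by rewrite in_setC.
pose x' : induced (~: N) := Sub x xN.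
suff /(_ (Sub y yN)) /= : forall u : induced (~: N), val u == x by apply/negP.
apply: (connected_ind (x := x') cN) => //= u v /eqP ux uv.
by have := valP v; rewrite !inE -ux [edge _ _]uv.
Qed.

Lemma clique_embeds (S G : sgraph) (T : {set G}) :
  #|S| <= #|T| -> (forall u v : S, edge u v = (u != v)) ->
  {in T &, forall u v, edge u v = (u != v)} -> embeds S G.
Proof.
move=> ST cliqueS cliqueT; apply/embedsP.
pose f u := enum_val (widen_ord ST (enum_rank u)).
have fI : injective f.
  move=> u v /enum_val_inj/(congr1 val) uv.
  by apply: enum_rank_inj; apply: val_inj.
exists f => // u v; rewrite cliqueS cliqueT ?(inj_eq fI) //; exact: enum_valP.
Qed.

(** Otherwise [a], [w], [b], [c] would be a 4-cycle. *)
Lemma triangle_unique_nbr (S : sgraph) (a b c w : S) :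
  quad_free S -> is_triangle (@edge S) a b c -> w != c ->
  edge w a -> ~~ edge w b.
Proof.
move=> qS /and3P[ab bc ac] wc wa; apply/negP => wb.
have := qS a w b c; rewrite /is_quad edge_sym wa wb bc edge_sym ac wc andbT.
by apply/negP; rewrite negbK; apply: contraTneq ab => ->; rewrite edge_irrefl.
Qed.

Lemma is_triangle_rot (S : sgraph) (a b c : S) :
  is_triangle (@edge S) a b c = is_triangle (@edge S) b c a.
Proof.
by rewrite /is_triangle (edge_sym c a) (edge_sym b a) [LHS]andbC -andbA.
Qed.

Lemma is_triangle_swap (S : sgraph) (a b c : S) :
  is_triangle (@edge S) a b c = is_triangle (@edge S) a c b.
Proof.
by rewrite /is_triangle (edge_sym c b) [LHS]andbCA [RHS]andbC -andbA.
Qed.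

(** * Graphs with a triangle that satisfy the constraints on [S] *)

Section Classification.
Variable S : sgraph.
Hypotheses (cS : connected S) (qS : quad_free S) (iS : alpha_le2 S).
Hypotheses (pS : P4_free S) (kS : twoK2_free S).

(** Having no 4-cycle makes [z] pendant at [a], and a fifth vertex [w] is impossible. If [w] is
    adjacent to [a], then [bc] and [zw] form a [2K_2], or [z], [b], [w] are independent. If not,
    then [w], [z], [a], [b] is an induced path, or [w], [z], [b] are independent. *)
Lemma pendant_triangle_Z1 (a b c z : S) :
  is_triangle (@edge S) a b c -> z \notin [:: a; b; c] -> edge a z ->
  isomorphic S Z1.
Proof.
move=> abc; rewrite !inE !negb_or => /and3P[za zb zc] az.
have Nbz : ~~ edge z b.
  by apply: (triangle_unique_nbr qS abc) => //; rewrite edge_sym.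
have Ncz : ~~ edge z c.
  apply: (triangle_unique_nbr (a := a) (c := b) qS _ zb).
    by rewrite is_triangle_swap.
  by rewrite edge_sym az.
have [ab bc ac] := and3P abc.
suff all4 w : w \in [:: a; b; c; z].
  apply: isomorphic_sym; apply: embeds_isomorphic.
    apply: (@Z1_embeds S a b c z).
    by rewrite /is_paw abc az !(edge_sym _ z) Nbz.
  rewrite [#|Z1|]card_option card_ord.
  apply: leq_trans (card_size [:: a; b; c; z]).
  by apply/subset_leq_card/subsetP => w _; exact: all4.
apply/negPn/negP; rewrite !inE !negb_or => /and4P[wa wb wc wz].
(* A vertex not adjacent to [a] is not adjacent to [b1] either: depending on [wz], the vertices [w],
   [z], [a], [b1] would give a 4-cycle or an induced path. *)
have opp (b1 b2 : S) : is_triangle (@edge S) a b1 b2 -> ~~ edge z b1 ->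
    w != b1 -> w != b2 -> z != b1 -> ~~ edge w a -> ~~ edge w b1.
  move=> /and3P[ab1 b12 _] zb1 wb1 wb2 zb1' Nwa; apply/negP => b1w.
  case wz': (edge w z).
    have := qS w z a b1; rewrite /is_quad wz' (edge_sym z) az ab1.
    by rewrite (edge_sym b1) b1w wa zb1'.
  have := pS z a b1 w; rewrite /is_P4 (edge_sym z) az ab1 (edge_sym b1) b1w.
  by rewrite zb1 (edge_sym z) wz' (edge_sym a) Nwa.
case wa': (edge w a).
  have Nbw := triangle_unique_nbr qS abc wc wa'.
  have Ncw : ~~ edge w c.
    by apply: (triangle_unique_nbr qS _ wb wa'); rewrite is_triangle_swap.
  case wz': (edge w z).
    have := kS b c z w; rewrite /is_2K2 bc edge_sym wz'.
    by rewrite !(edge_sym _ z) !(edge_sym _ w) Nbz Ncz Nbw Ncw.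
  have := iS z b w; rewrite /is_independent3 zb eq_sym wz eq_sym wb Nbz.
  by rewrite edge_sym wz' edge_sym Nbw.
have Nwb : ~~ edge w b by apply: opp abc _ _ _ _ _; rewrite ?wa'.
case wz': (edge w z).
  have := pS w z a b; rewrite /is_P4 wz' edge_sym az ab wa' Nwb.
  by rewrite Nbz.
have := iS w z b; rewrite /is_independent3 wz wb zb wz' Nwb Nbz.
by [].
Qed.

(** An edge leaving the triangle starts, after a rotation, at its first vertex and yields [Z1];
    without such an edge, connectedness makes the triangle everything. *)
Lemma triangle_or_Z1 (a b c : S) :
  is_triangle (@edge S) a b c ->
  (forall z, z \in [:: a; b; c]) \/ isomorphic S Z1.
Proof.
move=> abc.
have bca : is_triangle (@edge S) b c a by rewrite -is_triangle_rot.
have cab : is_triangle (@edge S) c a b by rewrite -is_triangle_rot.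
case: (pickP [pred p : S * S | (p.1 \in [:: a; b; c])
  && (p.2 \notin [:: a; b; c]) && edge p.1 p.2]) => [[t z]|closed] /=.
  case/andP=> /andP[]; rewrite 3!inE => /or3P[] /eqP-> zN tz; right.
  - exact: pendant_triangle_Z1 abc zN tz.
  - apply: pendant_triangle_Z1 bca _ tz.
    by apply: contra zN; rewrite !inE => /or3P[]->; rewrite ?orbT.
  - apply: pendant_triangle_Z1 cab _ tz.
    by apply: contra zN; rewrite !inE => /or3P[]->; rewrite ?orbT.
left; apply: (connected_ind (x := a) cS) => [|u v uT uv] /=.
  exact: mem_head.
by apply/negPn/negP => vN; have := closed (u, v); rewrite /= uT vN uv.
Qed.

End Classification.

Lemma star2_path3 : isomorphic (star 2) (path_graph 3).
Proof.
apply: embeds_isomorphic; last by rewrite card_option !card_ord.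
pose mid : path_graph 3 := Ordinal (isT : 1 < 3).
apply: (@star_embeds (path_graph 3) 2 mid [set ord0; ord_max]).
- by rewrite cards2.
- by move=> i; rewrite !inE => /orP[] /eqP->.
- by move=> i j; rewrite !inE => /orP[] /eqP-> /orP[] /eqP->.
Qed.

Lemma isomorphic_trans_embeds (X Y G : sgraph) :
  isomorphic X Y -> embeds Y G -> embeds X G.
Proof. by move/isomorphic_embeds; apply: embeds_trans. Qed.

Lemma triangle_free_kconnected_star (G : sgraph) k r :
  0 < k -> kconnected k G -> triangle_free G -> r <= k -> embeds (star r) G.
Proof.
move=> k_gt0 kG tG rk; have /card_gt0P[x _] : 0 < #|G|.
  by case: kG => kG _; apply: leq_trans kG.
apply: (star_embeds (x := x) (leq_trans rk (kconnected_degree x kG))) => y.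
  by rewrite inE.
move=> z; rewrite !inE => xy xz.
by have := tG x y z; rewrite /is_triangle xy xz andbT.
Qed.

Lemma small_star_embeds (G : sgraph) k r :
  0 < k -> kconnected k G -> r <= 1 -> embeds (star r) G.
Proof.
move=> k_gt0 kG r1; have /card_gt0P[x _] : 0 < #|G|.
  by case: kG => kG _; apply: leq_trans kG.
have /card_gt0P[y] := leq_trans k_gt0 (kconnected_degree x kG).
rewrite inE => xy; apply: (@star_embeds G r x [set y]); first by rewrite cards1.
  by move=> z; rewrite inE => /eqP->.
by move=> z t; rewrite !inE => /eqP-> /eqP->; rewrite edge_irrefl.
Qed.

(** Two leaves give the excluded [P_3], and a star with at most one leaf lies in every 4-connected
    graph. *)
Lemma isomorphic_star_gt2 (X : sgraph) r :
  ~ isomorphic X (path_graph 3) ->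
  (exists2 G : sgraph, kconnected 4 G & ~~ embeds X G) ->
  isomorphic X (star r) -> 2 < r.
Proof.
move=> XP3 [G kG XG] Xr; rewrite ltnNge leq_eqVlt ltnS negb_or.
apply/andP; split; apply/negP; [move/eqP=> r2|move=> r1].
  apply: XP3; apply: embeds_isomorphic; last first.
    rewrite card_ord.
    by have [f fB _] := Xr; rewrite (bij_eq_card fB) r2 card_option card_ord.
  rewrite r2 in Xr; apply: isomorphic_trans_embeds Xr _.
  exact: isomorphic_embeds star2_path3.
move/negP: XG; apply; apply: isomorphic_trans_embeds Xr _.
exact: small_star_embeds kG r1.
Qed.

Lemma star_not_claw_free (X : sgraph) r :
  2 < r -> isomorphic X (star r) -> ~ claw_free X.
Proof.
move=> r2 /isomorphic_sym/isomorphic_embeds/claw_free_embeds H /H.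
by move/star_claw_free; rewrite leqNgt r2.
Qed.

Lemma star_not_alpha_le2 (X : sgraph) r :
  2 < r -> isomorphic X (star r) -> ~ alpha_le2 X.
Proof. by move=> r2 Xr /alpha_le2_claw_free; exact: star_not_claw_free Xr. Qed.

(** * Necessity: the obstructions determine the pair *)

Section Necessity.
Variables R S : sgraph.
Hypotheses (cR : connected R) (cS : connected S).
Hypotheses (RP3 : ~ isomorphic R (path_graph 3)).
Hypotheses (SP3 : ~ isomorphic S (path_graph 3)).
Hypothesis free : exists2 G : sgraph, kconnected 4 G & pair_free R S G.
Hypothesis RS_H2 : H2_forbidden_pair R S.

Lemma pair_embeds (G : sgraph) :
  kconnected 4 G -> ~ has_H2 G -> embeds R G \/ embeds S G.
Proof.
move=> kG nH2; case RG: (embeds R G); first by left.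
case SG: (embeds S G); first by right.
by case: nH2; apply: RS_H2 => //; apply/pair_freeP; rewrite RG SG.
Qed.

Lemma R_star_gt2 r : isomorphic R (star r) -> 2 < r.
Proof.
apply: isomorphic_star_gt2 => //.
by have [G kG /pair_freeP[RG _]] := free; exists G.
Qed.

Lemma S_star_gt2 r : isomorphic S (star r) -> 2 < r.
Proof.
apply: isomorphic_star_gt2 => //.
by have [G kG /pair_freeP[_ SG]] := free; exists G.
Qed.

(** Lying in [K44] makes [R] triangle-free and [P_4]-free, hence a star as soon as it has no
    4-cycle; the other four obstructions are then distributed in turn. *)
Lemma forbidden_pair_claw_Z1 :
  embeds R K44 -> isomorphic R (star 3) /\ isomorphic S Z1.
Proof.
move=> RK44.
have R_tri := triangle_free_embeds RK44 K44_triangle_free.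
have R_P4 := P4_free_embeds RK44 K44_P4_free.
have R_star : quad_free R -> exists2 r, isomorphic R (star r) & 2 < r.
  move=> qR; have [r Rr] := connected_star cR R_tri qR R_P4.
  by exists r => //; exact: R_star_gt2.
have S_star : triangle_free S -> quad_free S -> P4_free S ->
    exists2 r, isomorphic S (star r) & 2 < r.
  move=> tS qS pS; have [r Sr] := connected_star cS tS qS pS.
  by exists r => //; exact: S_star_gt2.
(* In this graph without 4-cycles [R] would be a star with at least three leaves, against
   claw-freeness. *)
have S_L : embeds S line_petersen.
  case: (pair_embeds line_petersen_4conn line_petersen_no_H2) => // RL.
  have [r Rr r2] := R_star (quad_free_embeds RL line_petersen_quad_free).
  case: (star_not_claw_free r2 Rr).
  exact: claw_free_embeds RL line_petersen_claw_free.
have S_quad := quad_free_embeds S_L line_petersen_quad_free.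
pose H := K1_K3_square_join.
have in_H : embeds R H \/ embeds S H.
  exact: pair_embeds K1_K3_square_join_4conn K1_K3_square_join_no_H2.
have H_alpha (X : sgraph) : embeds X H -> alpha_le2 X.
  by move/alpha_le2_embeds; apply; exact: K1_K3_square_join_alpha_le2.
have H_P4 (X : sgraph) : embeds X H -> P4_free X.
  by move/P4_free_embeds; apply; exact: K1_K3_square_join_P4_free.
have in_D := pair_embeds K4_join_3K1_4conn K4_join_3K1_no_H2.
(* Otherwise [S] has no triangle. It is then not in [H], where it would be a star with three
   independent leaves, so [R] is in [H]; both choices for [K4_join_3K1] fail as well. *)
have R_rob : embeds R robertson.
  case: (pair_embeds robertson_4conn robertson_no_H2) => // SC.
  have S_tri := triangle_free_embeds SC robertson_triangle_free.
  have RH : embeds R H.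
    case: in_H => // SH; have [r Sr r2] := S_star S_tri S_quad (H_P4 _ SH).
    by case: (star_not_alpha_le2 r2 Sr (H_alpha _ SH)).
  case: in_D => [RD|SD].
    have [|r Rr r2] := R_star.
      (* In a triangle-free graph a 4-cycle has no chord, so excluding induced 4-cycles suffices. *)
      move=> a b c d; apply/negP => abcd.
      have /and5P[ab bc cd _ _] := abcd.
      have := C4_free_embeds RD K4_join_3K1_C4_free a b c d.
      rewrite /is_C4 abcd.
      have := R_tri a b c; rewrite /is_triangle ab bc /= => ->.
      by have := R_tri b c d; rewrite /is_triangle bc cd /= => ->.
    by case: (star_not_alpha_le2 r2 Rr (H_alpha _ RH)).
  have S_P4 := P4_free_embeds SD K4_join_3K1_P4_free.
  have [r Sr r2] := S_star S_tri S_quad S_P4.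
  case: (star_not_claw_free r2 Sr).
  exact: claw_free_embeds S_L line_petersen_claw_free.
have [r Rr r2] := R_star (quad_free_embeds R_rob robertson_quad_free).
have SH : embeds S H.
  by case: in_H => // /H_alpha; case/(star_not_alpha_le2 r2 Rr).
have S_alpha := H_alpha _ SH.
have S_P4 := H_P4 _ SH.
have S_2K2 := twoK2_free_embeds SH K1_K3_square_join_twoK2_free.
have rR : embeds (star r) R by apply/isomorphic_embeds/isomorphic_sym.
have SZ1 : isomorphic S Z1.
  case: (pickP [pred p : S * S * S | is_triangle (@edge S) p.1.1 p.1.2 p.2])
      => [[[a b] c] /= abc|tri_free]; last first.
    have [|k Sk k2] := S_star _ S_quad S_P4.
      by move=> a b c; have /= -> := tri_free (a, b, c).
    by case: (star_not_alpha_le2 k2 Sk S_alpha).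
  have [Sabc|//] := triangle_or_Z1 cS S_quad S_alpha S_P4 S_2K2 abc.
  (* If [S] is a triangle, the given [{R, S}]-free graph is triangle-free with all degrees at least
     four. It then contains the star [R], which has at most four leaves because it lies in the
     4-regular [robertson]. *)
  have [G kG /pair_freeP[/negP RG /negP SG]] := free.
  case: RG; apply: isomorphic_trans_embeds Rr _.
  apply: (triangle_free_kconnected_star _ kG) => //; last first.
    have [x rx] := star_max_degree (embeds_trans rR R_rob).
    exact: leq_trans rx (robertson_degree x).
  move=> x y z; apply/negP => /and3P[xy yz xz]; apply: SG.
  have neq (X : sgraph) (u v : X) : edge u v -> u != v.
    by apply: contraTneq => ->; rewrite edge_irrefl.
  have /and3P[ab bc ac] := abc.
  apply: (clique_embeds (T := [set x; y; z])).
  - apply: (@leq_trans 3); last first.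
      rewrite setUC cardsU1 cards2 !inE negb_or (neq _ _ _ xy).
      by rewrite !(eq_sym z) (neq _ _ _ xz) (neq _ _ _ yz).
    apply: leq_trans (card_size [:: a; b; c]).
    by apply/subset_leq_card/subsetP => u _; exact: Sabc.
  - move=> u v; apply/idP/idP; first exact: neq.
    have := Sabc u; have := Sabc v; rewrite !inE.
    by do 2![case/or3P=> /eqP->]; rewrite ?eqxx // edge_sym.
  - move=> u v; rewrite !inE => uT vT; apply/idP/idP; first exact: neq.
    move: uT vT; rewrite -!orbA.
    by do 2![case/or3P=> /eqP->]; rewrite ?eqxx // edge_sym.
split=> //.
suff <- : r = 3 by [].
apply/eqP; rewrite eqn_leq r2 andbT; apply: star_alpha_le3.
apply: alpha_le3_embeds rR _.
(* [K4_join_3K1] has no four independent vertices and no induced [Z1], so it contains [R] and bounds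
   the number of leaves by three. *)
case: in_D => [RD|SD].
  exact: alpha_le3_embeds RD K4_join_3K1_alpha_le3.
case: Z1_not_paw_free; apply: paw_free_embeds K4_join_3K1_paw_free.
by apply: embeds_trans SD; apply/isomorphic_embeds/isomorphic_sym.
Qed.

End Necessity.

(** * Hamiltonian squares in claw-free and paw-free graphs *)

Section ClawPawFree.
Variable G : sgraph.
Hypotheses (kG : kconnected 4 G) (clawG : claw_free G) (pawG : paw_free G).

Lemma kconnected4_ind (P : pred G) (x : G) :
  P x -> (forall u v, P u -> edge u v -> P v) -> forall z, P z.
Proof.
move=> Px step z; have [_] := kG; move/(_ set0); rewrite cards0 => /(_ isT) cG.
have inC (u : G) : u \in ~: set0 by rewrite !inE.
pose x0 : induced (~: set0) := Sub x (inC x).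
have H := @connected_ind (induced (~: set0)) (fun u => P (val u)) x0 cG Px.
by apply: (H _ (Sub z (inC z))) => u v Pu uv; exact: step uv.
Qed.

(** Among three neighbours of [x] two are adjacent, since there is no claw. *)
Lemma vertex_in_triangle (x : G) : exists a b, is_triangle (@edge G) x a b.
Proof.
have := leq_trans (isT : 2 < 4) (kconnected_degree x kG).
case/card_gt2P=> a [b [c [[+ + +] [ab bc ca]]]]; rewrite !inE => xa xb xc.
have := clawG x a b c.
rewrite /is_claw xa xb xc /is_independent3 ab bc eq_sym ca /=.
rewrite !negb_and !negbK => /or3P[e1|e1|e1].
- by exists a, b; rewrite /is_triangle xa xb e1.
- by exists a, c; rewrite /is_triangle xa xc e1.
- by exists b, c; rewrite /is_triangle xb xc e1.
Qed.

(** The property spreads along edges. If [u] is adjacent to [a] and [b], then [u], [a], [b] is a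
    triangle, and paw-freeness puts a neighbour of [u] in it or next to [a] or [b]. *)
Lemma triangle_dominates (a b c z : G) :
  is_triangle (@edge G) a b c ->
  [|| edge z a && edge z b, edge z b && edge z c | edge z a && edge z c].
Proof.
move=> abc; pose dom z := [|| edge z a && edge z b, edge z b && edge z c
                            | edge z a && edge z c].
have nbr u v w : is_triangle (@edge G) u v w -> forall t, edge t u ->
    [|| t == v, t == w, edge t v | edge t w].
  move=> /[dup] uvw /and3P[uv vw uw] t tu; have := pawG u v w t.
  rewrite /is_paw uvw (edge_sym u t) tu /= negb_and !negbK !(edge_sym _ t).
  by move/orP=> [->|->]; rewrite !orbT.
have /and3P[ab bc ac] := abc.
have [dom_a dom_b dom_c] : [/\ dom a, dom b & dom c].
  by rewrite /dom !(edge_sym _ a) (edge_sym c) ab bc ac !orbT.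
have bca : is_triangle (@edge G) b c a by rewrite -is_triangle_rot.
have cab : is_triangle (@edge G) c a b by rewrite -is_triangle_rot.
(* By paw-freeness, one neighbour in the triangle already forces a second one. *)
have dom_edge t : [|| edge t a, edge t b | edge t c] -> dom t.
  case/or3P=> t1.
  - have /or4P[/eqP->|/eqP->|e|e] := nbr _ _ _ abc t t1 => //;
      by rewrite /dom t1 e ?orbT.
  - have /or4P[/eqP->|/eqP->|e|e] := nbr _ _ _ bca t t1 => //;
      by rewrite /dom t1 e ?orbT.
  - have /or4P[/eqP->|/eqP->|e|e] := nbr _ _ _ cab t t1 => //;
      by rewrite /dom t1 e ?orbT.
apply: (kconnected4_ind (P := dom) dom_a) => u v dom_u; rewrite edge_sym => uv.
case/or3P: dom_u => /andP[u1 u2].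
- have uab : is_triangle (@edge G) u a b by rewrite /is_triangle u1 u2 ab.
  have /or4P[/eqP->|/eqP->|e|e] := nbr _ _ _ uab v uv => //.
  + by apply: dom_edge; rewrite e.
  + by apply: dom_edge; rewrite e orbT.
- have ubc : is_triangle (@edge G) u b c by rewrite /is_triangle u1 u2 bc.
  have /or4P[/eqP->|/eqP->|e|e] := nbr _ _ _ ubc v uv => //.
  + by apply: dom_edge; rewrite e orbT.
  + by apply: dom_edge; rewrite e !orbT.
- have uac : is_triangle (@edge G) u a c by rewrite /is_triangle u1 u2 ac.
  have /or4P[/eqP->|/eqP->|e|e] := nbr _ _ _ uac v uv => //.
  + by apply: dom_edge; rewrite e.
  + by apply: dom_edge; rewrite e !orbT.
Qed.

(** Every edge [xy] lies in a triangle, because [y] has a neighbour other than [x] in a triangle at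
    [x]; two neighbours in the triangle on [xy] include [x] or [y]. *)
Lemma edge_dominates (x y z : G) : edge x y -> edge z x || edge z y.
Proof.
move=> xy; have [a [b xab]] := vertex_in_triangle x.
have [t xyt] : exists t, is_triangle (@edge G) x y t.
  have [xa ab xb] := and3P xab.
  have /or3P[] := triangle_dominates y xab => /andP[y1 y2].
  - by exists a; rewrite /is_triangle xy xa y2.
  - by exists a; rewrite /is_triangle xy xa y1.
  - by exists b; rewrite /is_triangle xy xb y2.
by have /or3P[] := triangle_dominates z xyt => /andP[-> _]; rewrite ?orbT.
Qed.

(** A neighbour [w] of [x] is adjacent to every nonneighbour of [x], and two such nonneighbours are
    not adjacent since an edge between them would dominate [x]; with [x] they would form a claw at
    [w]. *)
Lemma nonneighbour_unique (x y z : G) :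
  x != y -> x != z -> ~~ edge x y -> ~~ edge x z -> y = z.
Proof.
move=> xy xz Nxy Nxz; apply/eqP/negPn/negP => yz.
have [w [_ /and3P[xw _ _]]] := vertex_in_triangle x.
have wN u : ~~ edge x u -> edge w u.
  move=> Nxu; have := edge_dominates u xw.
  by rewrite !(edge_sym u) (negbTE Nxu).
have Nyz : ~~ edge y z.
  apply/negP => /(edge_dominates x); rewrite (negbTE Nxy) (negbTE Nxz).
  by [].
have := clawG w x y z.
by rewrite /is_claw /is_independent3 edge_sym xw !wN // xy xz yz Nxy Nxz Nyz.
Qed.

End ClawPawFree.

(** * Hamiltonian squares when each vertex has at most one nonneighbour *)

Section Matching.
Variable G : sgraph.
Hypothesis n_gt4 : 4 < #|G|.
Hypothesis deg4 : forall x : G, 4 <= #|[set y | edge x y]|.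
Hypothesis nonneighbour : forall x y z : G,
  x != y -> x != z -> ~~ edge x y -> ~~ edge x z -> y = z.

(** The default value makes the vertices adjacent to all others the fixed points of an
    involution. *)
Definition mate (x : G) := odflt x [pick y | (x != y) && ~~ edge x y].

Lemma mateP x y : x != y -> ~~ edge x y -> mate x = y.
Proof.
rewrite /mate => xy Nxy; case: pickP => [z /andP[xz Nxz]|/(_ y)] /=.
  exact: nonneighbour xz xy Nxz Nxy.
by rewrite xy Nxy.
Qed.

Lemma mate_nonneighbour x : mate x != x -> ~~ edge x (mate x).
Proof. by rewrite /mate; case: pickP => [y /andP[]|] //=; rewrite eqxx. Qed.

Lemma mateK : involutive mate.
Proof.
move=> x; case: (eqVneq (mate x) x) => [mx|mx]; first by rewrite !mx.
by apply: mateP => //; rewrite edge_sym mate_nonneighbour.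
Qed.

(** The enumeration rank selects one vertex from each nonadjacent pair. *)
Definition lowers := [seq x <- enum G | enum_rank x < enum_rank (mate x)].
Definition singles := [seq x <- enum G | mate x == x].
Definition half_singles := take (size singles)./2 singles.

(* Each vertex and its mate are about half the cycle apart. *)
Definition matched_cycle :=
  lowers ++ half_singles
    ++ map mate lowers ++ drop (size singles)./2 singles.

Lemma mem_lowers x : (x \in lowers) = (enum_rank x < enum_rank (mate x)).
Proof. by rewrite mem_filter mem_enum andbT. Qed.

Lemma mem_uppers x :
  (x \in map mate lowers) = (enum_rank (mate x) < enum_rank x).
Proof. by rewrite -{1}[x]mateK (mem_map (inv_inj mateK)) mem_lowers mateK. Qed.

Lemma mem_singles x : (x \in singles) = (mate x == x).
Proof. by rewrite mem_filter mem_enum andbT. Qed.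

Lemma matched_cycle_perm :
  perm_eq matched_cycle (lowers ++ map mate lowers ++ singles).
Proof.
by rewrite perm_cat2l perm_catCA perm_cat2l /half_singles cat_take_drop.
Qed.

Lemma mem_matched_cycle x : x \in matched_cycle.
Proof.
rewrite (perm_mem matched_cycle_perm) !mem_cat mem_lowers mem_uppers.
rewrite mem_singles -(inj_eq enum_rank_inj) -val_eqE /=.
by case: ltngtP.
Qed.

Lemma matched_cycle_uniq : uniq matched_cycle.
Proof.
rewrite (perm_uniq matched_cycle_perm) !cat_uniq.
rewrite (map_inj_uniq (inv_inj mateK)) !(filter_uniq _ (enum_uniq G)) andbT /=.
apply/andP; split; apply/hasPn => x.
  rewrite mem_cat mem_uppers mem_singles mem_lowers -(inj_eq enum_rank_inj).
  by rewrite -val_eqE /=; case: ltngtP.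
rewrite mem_uppers mem_singles -(inj_eq enum_rank_inj) -val_eqE /=.
by case: ltngtP.
Qed.

Lemma size_matched_cycle : size matched_cycle = #|G|.
Proof.
rewrite -(card_uniqP matched_cycle_uniq); apply: eq_card => x.
by rewrite mem_matched_cycle.
Qed.

Local Notation pos := (index^~ matched_cycle).
Local Notation h := (#|G|./2).

(** The nonadjacent pairs contribute an even number of vertices, so rounding down [size singles] and
    [#|G|] agrees. *)
Lemma half_size : size lowers + size half_singles = h.
Proof.
have /perm_size := matched_cycle_perm; rewrite size_matched_cycle => ->.
rewrite !size_cat size_map addnA addnn halfD odd_double doubleK add0n.
rewrite size_takel // -[X in _ <= X]odd_double_half -addnn addnCA leq_addr.
by [].
Qed.

(** The vertex and its mate have the same offset in the first and the third block, and the first two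
    blocks have total length [h]. *)
Lemma pos_mate x : x \in lowers -> pos (mate x) = pos x + h.
Proof.
move=> xl; have mxl : mate x \notin lowers.
  by rewrite mem_lowers mateK -leqNgt ltnW // -mem_lowers.
have mxs : mate x \notin half_singles.
  apply/negP => /mem_take; rewrite mem_singles mateK => /eqP mx.
  by move: xl; rewrite mem_lowers -mx ltnn.
rewrite /matched_cycle index_cat (negbTE mxl) index_cat (negbTE mxs).
rewrite index_cat (map_f mate xl) index_map; last exact: inv_inj mateK.
by rewrite index_cat xl -half_size addnA addnC.
Qed.

Lemma pos_nonneighbour (x y : G) : x != y -> ~~ edge x y ->
  pos y = pos x + h \/ pos x = pos y + h.
Proof.
move=> xy Nxy; have mx := mateP xy Nxy.
have my : mate y = x by rewrite -mx mateK.
have [xl|xl] := boolP (x \in lowers); first by left; rewrite -mx pos_mate.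
right; rewrite -{1}my pos_mate // mem_lowers my.
move: xl xy; rewrite mem_lowers mx -(inj_eq enum_rank_inj) -val_eqE /=.
by case: ltngtP.
Qed.

(** Four neighbours together with [x] and [y] make six vertices; hence half a turn is longer than
    two steps whenever some pair is nonadjacent. *)
Lemma nonneighbour_card (x y : G) : x != y -> ~~ edge x y -> 5 < #|G|.
Proof.
move=> xy Nxy; rewrite -cardsT (cardsD1 x) (cardsD1 y) !inE eq_sym xy /=.
apply: leq_trans (deg4 x) _; apply/subset_leq_card/subsetP => z.
rewrite !inE andbT => xz; apply/andP; split.
  by apply: contraNneq Nxy => <-.
by apply: contraTneq xz => ->; rewrite edge_irrefl.
Qed.

Lemma pos_next x :
  pos (next matched_cycle x) = (pos x).+1 \/
  pos (next matched_cycle x) = 0 /\ (pos x).+1 = #|G|.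
Proof.
rewrite -size_matched_cycle.
have := mem_matched_cycle x; have := matched_cycle_uniq.
case E: matched_cycle => [|y p] // U xp; rewrite next_nth xp.
have := xp; rewrite -index_mem ltnS leq_eqVlt => /orP[/eqP xl|xl].
  (* At the last position [next] falls back on the default of [nth], the head of the cycle. *)
  by right; rewrite xl nth_default // index_head.
by left; rewrite -[nth y p _]/(nth y (y :: p) _.+1) index_uniq.
Qed.

(** Nonadjacent vertices have positions differing by exactly [h], with [2 < h] and [h + 2 < #|G|];
    so neither way around are they one or two steps apart. *)
Lemma near_edge (x y : G) i : 0 < i <= 2 ->
  pos y = pos x + i \/ pos y + #|G| = pos x + i -> edge x y.
Proof.
move=> /andP[i_gt0 i_le2] near; apply/negPn/negP => Nxy.
have xy : x != y.
  apply/eqP => xy; case: near; rewrite xy => /eqP.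
    by rewrite -{1}[pos y]addn0 eqn_add2l eq_sym (gtn_eqF i_gt0).
  by rewrite eqn_add2l gtn_eqF // (leq_ltn_trans i_le2) // ltnW // ltnW.
have n6 := nonneighbour_card xy Nxy.
have h3 : 2 < h by rewrite geq_half_double.
have hn : h + 2 < #|G|.
  rewrite -[X in _ < X]odd_double_half -addnn addnCA ltn_add2l.
  exact: leq_trans h3 (leq_addl _ _).
have ih : i < h by exact: leq_ltn_trans h3.
case: near; case: (pos_nonneighbour xy Nxy) => -> /eqP.
- by rewrite eqn_add2l gtn_eqF.
- by rewrite -{1}[pos y]addn0 -addnA eqn_add2l ltn_eqF // addn_gt0 i_gt0 orbT.
- rewrite -addnA eqn_add2l gtn_eqF //.
  exact: leq_trans ih (leq_addr _ _).
- rewrite -addnA eqn_add2l gtn_eqF //.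
  by apply: leq_ltn_trans hn; rewrite leq_add2l.
Qed.

Lemma matched_cycle_H2 : has_H2 G.
Proof.
pose f := next matched_cycle.
have n_gt2 : 2 < #|G| by rewrite ltnW // ltnW.
have edge1 x : edge x (f x).
  apply: (near_edge (i := 1)) => //; rewrite addn1.
  by have [->|[-> ->]] := pos_next x; [left | right].
have edge2 x : edge x (f (f x)).
  apply: (near_edge (i := 2)) => //; rewrite addn2.
  (* At most one of the two steps wraps around; two wraps would force [#|G| = 1]. *)
  have [e2|[e2 e2']] := pos_next (f x); have [e1|[e1 e1']] := pos_next x.
  - by left; rewrite e2 e1.
  - by right; rewrite e2 e1 add1n e1'.
  - by right; rewrite e2 add0n -e2' e1.
  - by move: e2' n_gt2; rewrite e1 => <-.
exists matched_cycle.
  split; last exact: mem_matched_cycle.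
    by rewrite size_matched_cycle.
  rewrite /ucycle matched_cycle_uniq andbT.
  by apply: (cycle_from_next matched_cycle_uniq) => x _; exact: edge1.
have fI : injective f := can_inj (prev_next matched_cycle_uniq).
move=> x y /andP[xy /orP[|/existsP[z]]].
  by case/andP=> _ /orP[] /eqP <-; [|rewrite edge_sym]; exact: edge1.
case/andP=> /andP[_ xz] /andP[_ zy].
(* The middle vertex [z] is reached from [x] and left towards [y] in either direction; opposite
   directions would give [x = y]. *)
case/orP: xz => /eqP xz; case/orP: zy => /eqP zy.
- by rewrite -zy -xz; exact: edge2.
- by move: xy; rewrite -(inj_eq fI) /f xz zy eqxx.
- by move: xy; rewrite -xz -zy eqxx.
- by rewrite -xz -zy edge_sym; exact: edge2.
Qed.
End Matching.

Lemma claw_Z1_forbidden (R S : sgraph) :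
  isomorphic R (star 3) -> isomorphic S Z1 -> H2_forbidden_pair R S.
Proof.
move=> R_claw S_Z1 G kG /pair_freeP[RG SG].
have clawG : claw_free G.
  move=> x a b c; apply/negP => /and4P[xa xb xc /and4P[ab ac bc]].
  case/and3P=> Nab Nac Nbc; move/negP: RG; apply.
  apply: isomorphic_trans_embeds R_claw _.
  apply: (star_embeds (x := x) (A := [set a; b; c])).
  - by rewrite setUC cardsU1 cards2 !inE negb_or ab !(eq_sym c) ac bc.
  - by move=> y; rewrite !inE -orbA => /or3P[] /eqP->.
  - move=> y z; rewrite !inE -!orbA.
    by do 2![case/or3P=> /eqP->]; rewrite ?edge_irrefl // edge_sym.
have pawG : paw_free G.
  move=> a b c d; apply/negP => /Z1_embeds ZG; move/negP: SG; apply.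
  exact: isomorphic_trans_embeds S_Z1 ZG.
apply: matched_cycle_H2.
- by case: kG.
- by move=> x; exact: kconnected_degree.
- by move=> x y z; exact: nonneighbour_unique.
Qed.

Lemma H2_forbidden_pairC (R S : sgraph) :
  H2_forbidden_pair R S -> H2_forbidden_pair S R.
Proof.
by move=> RS G kG /pair_freeP[SG RG]; apply: RS => //; apply/pair_freeP.
Qed.

Theorem theorem1 (R S : sgraph) (hR : connected R) (hS : connected S)
    (hRP3 : ~ isomorphic R (path_graph 3))
    (hSP3 : ~ isomorphic S (path_graph 3))
    (hfree : exists2 G : sgraph, kconnected 4 G & pair_free R S G) :
  H2_forbidden_pair R S <->
  (isomorphic R (star 3) /\ isomorphic S Z1) \/
  (isomorphic R Z1 /\ isomorphic S (star 3)).
Proof.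
split=> [RS|[[Rc SZ]|[RZ Sc]]]; first last.
- by apply: H2_forbidden_pairC; exact: claw_Z1_forbidden.
- exact: claw_Z1_forbidden.
(* The graph lying in [K44] is the one that turns out to be the claw; the second case exchanges [R]
   and [S]. *)
case: (pair_embeds RS K44_4conn K44_no_H2) => [RK|SK]; [left|right].
  exact: forbidden_pair_claw_Z1 RK.
have hfree' : exists2 G : sgraph, kconnected 4 G & pair_free S R G.
  case: hfree => G kG /pair_freeP[RG SG]; exists G => //.
  exact/pair_freeP.
have SR := H2_forbidden_pairC RS.
by have [] := forbidden_pair_claw_Z1 hS hR hSP3 hRP3 hfree' SR SK.
Qed.
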